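(* Suppose $(A,B,C)$ is stabilizable and detectable, and let $X_\infty$ be the unique symmetric nonnegative definite (and stabilizing) solution of the algebraic Riccati equation $$0=A^TX_\infty+X_\infty A-X_\infty BB^TX_\infty+C^TC.$$ Assume it is possible to determine $m_*$ such that $\dim(\mathrm{range}(\mathcal{V}_{m_*}))=n$, and let $X_{m_*}^a=\mathcal{V}_{m_*}Y_{m_*}^\infty\mathcal{V}_{m_*}^T$ be the approximate solution of this algebraic Riccati equation obtained after $m_*$ iterations. Then $X_{m_*}^a=X_\infty$.
   Context: $A\in\mathbb{R}^{n\times n}$ is nonsingular, $B\in\mathbb{R}^{n\times s}$, $C\in\mathbb{R}^{p\times n}$, $Z\in\mathbb{R}^{n\times q}$. ''$(A,B,C)$ is stabilizable and detectable'' means that the pair $(A,B)$ is stabilizable and the pair $(C,A)$ is detectable. A solution $X$ of the algebraic Riccati equation is stabilizing if all eigenvalues of $A-BB^TX$ lie in the open left half plane. $\mathcal{V}_m\in\mathbb{R}^{n\times d}$ denotes a matrix with orthonormal columns spanning the $m$-th member of a nested sequence of (polynomial, extended or rational) block Krylov subspaces generated by $A^T$ and $N=[C^T,Z]$; thus, when $\dim(\mathrm{range}(\mathcal{V}_{m_*}))=n$, $\mathcal{V}_{m_*}$ is a square orthogonal matrix. Reduced data: $\mathcal{T}_m=\mathcal{V}_m^TA\mathcal{V}_m$, $B_m=\mathcal{V}_m^TB$, $Z_m=\mathcal{V}_m^TZ$, $C_m=C\mathcal{V}_m$. $Y_m(t)$ is the solution of the reduced differential Riccati equation $\dot Y_m=\mathcal{T}_m^TY_m+Y_m\mathcal{T}_m-Y_mB_mB_m^TY_m+C_m^TC_m$,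 $Y_m(0)=Z_mZ_m^T$, and $Y_m^\infty=\lim_{t\to\infty}Y_m(t)$. Known fact: if $(\mathcal{T}_m,B_m,C_m)$ is stabilizable and detectable, this limit exists and is the unique symmetric nonnegative definite solution, and the only stabilizing solution, of the reduced algebraic Riccati equation $$0=\mathcal{T}_m^TY_m^\infty+Y_m^\infty\mathcal{T}_m-Y_m^\infty B_mB_m^TY_m^\infty+C_m^TC_m.$$ *)

(* Defs.v *)
From HB Require Import structures.
From mathcomp Require Import all_boot all_order all_algebra.
From mathcomp Require Import complex.
From mathcomp Require Import all_classical all_reals all_analysis.

Set Implicit Arguments.
Unset Strict Implicit.
Unset Printing Implicit Defensive.

Import Order.TTheory GRing.Theory Num.Theory.
Import numFieldNormedType.Exports.

Local Open Scope classical_set_scope.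
Local Open Scope ring_scope.

Definition complexmx (R : realType) m n (M : 'M[R]_(m, n)) : 'M[R[i]]_(m, n) :=
  map_mx (real_complex R) M.

(* [eigenvalue] is about left (row) eigenvectors; the eigenvalues are the same
   as for right eigenvectors. *)
Definition hurwitz (R : realType) n (M : 'M[R]_n) : Prop :=
  forall l : R[i], eigenvalue (complexmx M) l -> complex.Re l < 0.

Definition stabilizable (R : realType) n s
    (A : 'M[R]_n) (B : 'M[R]_(n, s)) : Prop :=
  exists K : 'M[R]_(s, n), hurwitz (A - B *m K).

Definition detectable (R : realType) n p
    (C : 'M[R]_(p, n)) (A : 'M[R]_n) : Prop :=
  exists L : 'M[R]_(n, p), hurwitz (A - L *m C).

Definition sym_nonneg (R : realType) n (X : 'M[R]_n) : Prop :=
  X^T = X /\ forall v : 'cV[R]_n, 0 <= (v^T *m X *m v) 0 0.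

Definition riccati (R : realType) n s p (A : 'M[R]_n) (B : 'M[R]_(n, s))
    (C : 'M[R]_(p, n)) (X : 'M[R]_n) : 'M[R]_n :=
  A^T *m X + X *m A - X *m B *m B^T *m X + C^T *m C.

Definition stabilizing (R : realType) n s (A : 'M[R]_n) (B : 'M[R]_(n, s))
    (X : 'M[R]_n) : Prop :=
  hurwitz (A - B *m B^T *m X).

(* A classical solution on [0, +oo[: continuity at 0 is one-sided, and the
   values of Y at negative times are irrelevant. *)
Definition dre_solution (R : realType) n s p q (A : 'M[R]_n) (B : 'M[R]_(n, s))
    (C : 'M[R]_(p, n)) (Z : 'M[R]_(n, q)) (Y : R -> 'M[R]_n) : Prop :=
  [/\ {within `[0, +oo[, continuous Y},
      forall t : R, 0 < t -> is_derive t 1 Y (riccati A B C (Y t))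
    & Y 0 = Z *m Z^T].

Section Krylov.
Variables (F : fieldType) (n r : nat) (A : 'M[F]_n) (N : 'M[F]_(n, r)).

(* [N, A N, ..., A^(m-1) N] *)
Definition poly_krylov m : 'M[F]_(n, \sum_(j < m) r) :=
  \mxrow_(j < m) (A ^+ j *m N).

(* [N, A N, ..., A^(m-1) N, A^-1 N, ..., A^-m N] *)
Definition ext_krylov m : 'M[F]_(n, \sum_(j < m) r + \sum_(j < m) r) :=
  row_mx (poly_krylov m) (\mxrow_(j < m) (invmx (A ^+ j.+1) *m N)).

(* [N, (A - s_0 I)^-1 N, ..., (A - s_0 I)^-1 ... (A - s_(m-2) I)^-1 N] *)
Definition rat_krylov (s : nat -> F) m : 'M[F]_(n, \sum_(j < m) r) :=
  \mxrow_(j < m) ((\prod_(i < j) invmx (A - (s i)%:M)) *m N).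

End Krylov.

Inductive krylov_kind (R : realType) :=
  | Polynomial
  | Extended
  | Rational of (nat -> R[i]).

Arguments Polynomial {R}.
Arguments Extended {R}.

(* The columns of V form an orthonormal basis of the m-th Krylov subspace.
   Column spaces are compared as row spaces of transposes.  Shifts may be
   complex: then the complexification of range V is the complex rational Krylov
   space, as happens when nonreal shifts come in conjugate pairs. *)
Definition krylov_basis (R : realType) n r d (k : krylov_kind R)
    (A : 'M[R]_n) (N : 'M[R]_(n, r)) (m : nat) (V : 'M[R]_(n, d)) : Prop :=
  V^T *m V = 1%:M /\
  match k with
  | Polynomial => (V^T == (poly_krylov A N m)^T)%MS
  | Extended => (V^T == (ext_krylov A N m)^T)%MS
  | Rational s =>
      (forall i, (i.+1 < m)%N -> complexmx A - (s i)%:M \in unitmx) /\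
      ((complexmx V)^T ==
         (rat_krylov (complexmx A) (complexmx N) s m)^T)%MS
  end.

(* Main.v *)
Require Import Defs.
From mathcomp Require Import all_boot all_order all_algebra.
From mathcomp Require Import complex.
From mathcomp Require Import ring lra.
From mathcomp Require Import all_classical all_reals all_analysis.

Set Implicit Arguments.
Unset Strict Implicit.
Unset Printing Implicit Defensive.

Import Order.TTheory GRing.Theory Num.Theory.
Import numFieldNormedType.Exports.

Local Open Scope classical_set_scope.
Local Open Scope ring_scope.

(**
  Since [V] is square orthogonal, the reduced equations are the original ones in
  an orthonormal basis, and what is left is the convergence of the differential
  Riccati flow [W] from any [W(0) >= 0] to the stabilizing solution [X].

  Put [S = B B^T], [E = W - X] and [F = A - S W]. Then
    [W' = F^T W + W F + W S W + C^T C],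
    [E' = F^T E + E F + E S E = (A - S X)^T E + E (A - S X) - E S E].
  A comparison principle says that [J' >= G^T J + J G] and [J(0) >= 0] imply
  [J >= 0]. Let [P, Q > 0] be Lyapunov matrices of the Hurwitz matrices [A - S X]
  and [A - L C]. For suitable constants the principle applies to [g P - E] and then
  to [k P - t E], so [t E] is bounded above; it applies to [W], so [E >= - X]; and,
  with [G = F], it applies to [t E + k (Q + c W)], because [Q + c W] gains at least
  [1/2 I] from detectability. So [t E] is bounded, and [E] tends to [0].
*)

(** * Lyapunov matrices of Hurwitz matrices *)

(** The constant [2 ^+ n], cruder than the sharp [n], comes straight from induction with
    [(s + x)^2 <= 2 s^2 + 2 x^2]. *)
Lemma sqr_sum_le (R : realFieldType) (n : nat) (a : nat -> R) :
  (\sum_(i < n) a i) ^+ 2 <= 2 ^+ n * \sum_(i < n) a i ^+ 2.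
Proof.
elim: n => [|n IH]; first by rewrite !big_ord0 expr0n mulr0.
rewrite !big_ord_recr /= (exprS 2).
move: (\sum_(i < n) a i) (\sum_(i < n) a i ^+ 2) IH => s q IH.
have h1 : 1 <= 2 ^+ n :> R by apply: exprn_ege1; lra.
have h2 : a n ^+ 2 <= 2 ^+ n * a n ^+ 2 by rewrite ler_peMl // sqr_ge0.
have h3 := sqr_ge0 (s - a n).
move: (2 ^+ n) IH h2 => t IH h2; move: (a n) h2 h3 => x h2 h3; lra.
Qed.

(* Each new weight is small enough for its diagonal term to absorb the
   coupling with the previous coordinates. *)
Lemma triangular_weights (R : realFieldType) (n : nat) (al b : R) : 0 < al ->
  exists d : nat -> R, (forall i, 0 < d i) /\ exists2 c, 0 < c &
    forall a : nat -> R, c * (\sum_(i < n) a i ^+ 2) <=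
      \sum_(i < n) d i * (al * a i ^+ 2 - b * a i * \sum_(j < i) a j).
Proof.
move=> al0; elim: n => [|n [d [d0 [c c0 dP]]]].
  exists (fun=> 1); split=> //; exists 1 => // a.
  by rewrite !big_ord0 mulr0.
(* With the new weight [e = c / k], the coupling to the earlier coordinates costs at most [c / 2]
   times their sum of squares. The summand 1 keeps [k] positive when [b = 0]. *)
pose k := b ^+ 2 / al * 2 ^+ n + 1.
have k0 : 0 < k.
  rewrite ltr_wpDl // mulr_ge0 ?exprn_ge0 // divr_ge0 ?sqr_ge0 //; lra.
pose e := c / k.
have e0 : 0 < e by rewrite divr_gt0.
exists (fun i => if i == n then e else d i); split=> [i|]; first by case: eqP.
exists (Num.min (c / 2) (e * al / 2)).
  by rewrite lt_min; apply/andP; split; [lra|apply: divr_gt0; [exact: mulr_gt0|lra]].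
move=> a; rewrite !big_ord_recr /= eqxx.
under [X in _ <= X + _]eq_bigr => i _ do rewrite (ltn_eqF (ltn_ord i)).
have := dP a; have := sqr_sum_le n a.
set s := \sum_(i < n) a i; set q := \sum_(i < n) a i ^+ 2.
set D := \sum_(i < n) _ => hs hD.
have q0 : 0 <= q by apply: sumr_ge0 => i _; exact: sqr_ge0.
set x := a n.
(* Young's inequality, spending half of the diagonal term [al * x ^+ 2]. *)
have hb : b * x * s <= al / 2 * x ^+ 2 + b ^+ 2 / al / 2 * s ^+ 2.
  have := sqr_ge0 (al * x - b * s) => h.
  rewrite -(ler_pM2l al0) -subr_ge0.
  rewrite (_ : _ - _ = (al * x - b * s) ^+ 2 / 2); first by apply: divr_ge0 => //; lra.
  by field; apply: lt0r_neq0.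
have hbs : b ^+ 2 / al / 2 * s ^+ 2 <= b ^+ 2 / al / 2 * (2 ^+ n * q).
  by apply: ler_wpM2l => //; rewrite !divr_ge0 ?sqr_ge0 //; lra.
have hq : e * (b ^+ 2 / al / 2 * (2 ^+ n * q)) <= c / 2 * q.
  rewrite (_ : e * _ = (k - 1) * e / 2 * q); last first.
    by rewrite /k; field; apply: lt0r_neq0.
  apply: ler_wpM2r => //; rewrite ler_pM2r ?invr_gt0 ?ltr0n //.
  by rewrite mulrBl mul1r /e mulrCA divff ?lt0r_neq0 // mulr1 -/e; lra.
have he := ler_wpM2l (ltW e0) (lerD hb hbs).
have m1 : Num.min (c / 2) (e * al / 2) * q <= c / 2 * q.
  by apply: ler_wpM2r => //; rewrite ge_min lexx.
have m2 : Num.min (c / 2) (e * al / 2) * x ^+ 2 <= e * al / 2 * x ^+ 2.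
  by apply: ler_wpM2r; rewrite ?sqr_ge0 // ge_min lexx orbT.
lra.
Qed.

(** * The standard bilinear form on column vectors *)

Definition dot (R : pzRingType) n (u v : 'cV[R]_n) : R := (u^T *m v) 0 0.

Section DotTheory.
Variables (R : comNzRingType) (n : nat).
Implicit Types (u v w : 'cV[R]_n) (a : R).

Lemma dotE u v : dot u v = \sum_i u i 0 * v i 0.
Proof. by rewrite /dot mxE; apply: eq_bigr => i _; rewrite mxE. Qed.

Lemma dotC u v : dot u v = dot v u.
Proof. by rewrite !dotE; apply: eq_bigr => i _; rewrite mulrC. Qed.

Lemma dotDr u v w : dot u (v + w) = dot u v + dot u w.
Proof. by rewrite /dot mulmxDr mxE. Qed.

Lemma dotNr u v : dot u (- v) = - dot u v.
Proof. by rewrite /dot mulmxN mxE. Qed.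

Lemma dotBr u v w : dot u (v - w) = dot u v - dot u w.
Proof. by rewrite dotDr dotNr. Qed.

Lemma dotZr a u v : dot u (a *: v) = a * dot u v.
Proof. by rewrite /dot -scalemxAr mxE. Qed.

Lemma dotDl u v w : dot (u + v) w = dot u w + dot v w.
Proof. by rewrite ![dot _ w]dotC dotDr. Qed.

Lemma dotNl u v : dot (- u) v = - dot u v.
Proof. by rewrite ![dot _ v]dotC dotNr. Qed.

Lemma dotBl u v w : dot (u - v) w = dot u w - dot v w.
Proof. by rewrite dotDl dotNl. Qed.

Lemma dotZl a u v : dot (a *: u) v = a * dot u v.
Proof. by rewrite ![dot _ v]dotC dotZr. Qed.

Lemma dot_mulmx m (A : 'M[R]_(n, m)) u (v : 'cV[R]_m) :
  dot u (A *m v) = dot (A^T *m u) v.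
Proof. by rewrite /dot trmx_mul trmxK mulmxA. Qed.

Lemma dot_delta (A : 'M[R]_n) i j :
  dot (delta_mx i 0) (A *m delta_mx j 0) = A i j.
Proof. by rewrite /dot trmx_delta -rowE -colE !mxE. Qed.

Lemma dot_sym_tr (A : 'M[R]_n) :
  (forall u v, dot u (A *m v) = dot v (A *m u)) -> A^T = A.
Proof. by move=> sA; apply/matrixP => i j; rewrite mxE -!dot_delta sA. Qed.

End DotTheory.

Lemma dot0r (R : pzRingType) n (u : 'cV[R]_n) : dot u 0 = 0.
Proof. by rewrite /dot mulmx0 mxE. Qed.

Lemma dot0l (R : pzRingType) n (u : 'cV[R]_n) : dot 0 u = 0.
Proof. by rewrite /dot trmx0 mul0mx mxE. Qed.

Lemma dot_ge0 (R : realDomainType) n (u : 'cV[R]_n) : 0 <= dot u u.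
Proof. by rewrite dotE sumr_ge0 // => i _; rewrite -expr2 sqr_ge0. Qed.

Lemma ex_lb_gt0 (R : realFieldType) (I : finType) (f : I -> R) :
  (forall i, 0 < f i) -> exists2 c, 0 < c & forall i, c <= f i.
Proof.
(* Starting the minimum at 1 also covers an empty [I]. *)
move=> f0; exists (\big[Num.min/1]_i f i); last by move=> i; exact: bigmin_le.
by apply: lt_bigmin.
Qed.

(** * Dissipative triangular matrices and real parts of Hermitian forms *)

Section ComplexForm.
Variable R : rcfType.
Local Notation Re := (@complex.Re R).
Local Notation toC := (map_mx (real_complex R)).
Local Open Scope sesquilinear_scope.

Lemma Re_sum (I : Type) (r : seq I) (P : pred I) (F : I -> R[i]) :
  Re (\sum_(i <- r | P i) F i) = \sum_(i <- r | P i) Re (F i).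
Proof. by apply: (big_morph Re) => // -[a b] [c d]. Qed.

Lemma Re_realM (a : R) (z : R[i]) : Re ((real_complex R a) * z) = a * Re z.
Proof. by case: z => x y /=; rewrite mul0r subr0. Qed.

Lemma Re_le_normc (z : R[i]) : Re z <= Normc.normc z.
Proof.
case: z => x y /=; apply: le_trans (ler_norm x) _.
by rewrite -sqrtr_sqr ler_wsqrtr // lerDl sqr_ge0.
Qed.

Lemma Re_conjM (z : R[i]) : Re (z^* * z) = Normc.normc z ^+ 2.
Proof.
case: z => x y /=; rewrite sqr_sqrtr ?addr_ge0 ?sqr_ge0 //.
by rewrite !expr2 mulNr opprK.
Qed.

Lemma Re_conjMr (x z : R[i]) : Re (x^* * (z * x)) = Re z * Normc.normc x ^+ 2.
Proof.
case: x => x y; case: z => a b /=; rewrite sqr_sqrtr ?addr_ge0 ?sqr_ge0 //.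
ring.
Qed.

Lemma normc_conj (z : R[i]) : Normc.normc z^* = Normc.normc z.
Proof. by case: z => x y /=; rewrite sqrrN. Qed.

Lemma normc_ge0 (z : R[i]) : 0 <= Normc.normc z.
Proof. by case: z => x y /=; exact: sqrtr_ge0. Qed.

(** The matrix is lower triangular: row [i] contributes [Re (T i i) |y_i|^2] and couplings only with
    [j < i], each at most [b |y_i| |y_j|]. This is the situation of [triangular_weights]. *)
Lemma trig_dissipative n (T : 'M[R[i]]_n) :
  is_trig_mx T -> (forall i, Re (T i i) < 0) ->
  exists d : 'I_n -> R, (forall i, 0 < d i) /\ exists2 c, 0 < c &
    forall y : 'cV[R[i]]_n,
      \sum_i d i * Re ((y i 0)^* * (T *m y) i 0) <=
      - c * \sum_i Normc.normc (y i 0) ^+ 2.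
Proof.
move=> /is_trig_mxP trT T0.
have [al al0 alT] : exists2 al, 0 < al & forall i, al <= - Re (T i i).
  by apply: ex_lb_gt0 => i; rewrite oppr_gt0.
pose b := \sum_i \sum_j Normc.normc (T i j).
have bT i j : Normc.normc (T i j) <= b.
  rewrite /b (bigD1 i) //= (bigD1 j) //= -addrA lerDl addr_ge0 //.
    by apply: sumr_ge0 => k _; exact: normc_ge0.
  by apply: sumr_ge0 => k _; apply: sumr_ge0 => l _; exact: normc_ge0.
have [d [d0 [c c0 dP]]] := triangular_weights n b al0.
exists d; split=> //; exists c => // y.
(* The moduli, extended by 0 to a sequence indexed by [nat]. *)
pose a k := oapp (fun i : 'I_n => Normc.normc (y i 0)) 0 (insub k).
have aE (i : 'I_n) : a i = Normc.normc (y i 0) by rewrite /a valK.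
rewrite mulNr lerNr; apply: le_trans (_ : c * \sum_(i < n) a i ^+ 2 <= _).
  by rewrite ler_pM2l //; apply: ler_sum => i _; rewrite aE.
apply: le_trans (dP a) _; rewrite -sumrN; apply: ler_sum => i _.
rewrite -[leRHS]mulrN ler_pM2l //.
rewrite (big_ord_widen n (fun j => a j)) 1?ltnW // mulr_sumr.
rewrite mxE mulr_sumr Re_sum [X in _ <= - X](bigD1 i) //= Re_conjMr opprD aE.
apply: lerD; first by rewrite -mulNr; apply: ler_wpM2r; rewrite ?sqr_ge0.
rewrite lerN2 (bigID (fun j : 'I_n => (j < i)%N)) /=.
rewrite [X in _ + X]big1 ?addr0; last first.
  move=> j /andP[ji]; rewrite -leqNgt leq_eqVlt => /orP[/eqP/val_inj ij|ij].
    by rewrite ij eqxx in ji.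
  by rewrite trT // mul0r mulr0.
rewrite [X in _ <= X](eq_bigl (fun j : 'I_n => (j != i) && (j < i)%N)); last first.
  by move=> j; rewrite andb_idl // => ji; rewrite -val_eqE /= ltn_eqF.
apply: ler_sum => j _; apply: le_trans (Re_le_normc _) _.
rewrite !Normc.normcM normc_conj !aE mulrCA mulrA.
by do 2![apply: ler_wpM2r; first exact: normc_ge0].
Qed.

(** On real vectors, taking real parts of the entries commutes with the bilinear form; so a weighted
    form in the complex coordinates [U v] comes from a real matrix. *)
Lemma dot_Re_form n (U : 'M[R[i]]_n) (d : 'I_n -> R) (v w : 'cV[R]_n) :
  dot v (map_mx Re (U^t* *m diag_mx (\row_i real_complex R (d i)) *m U) *m w) =
  \sum_i d i * Re (((U *m toC v) i 0)^* * (U *m toC w) i 0).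
Proof.
have ReM (H : 'M[R[i]]_n) :
    dot v (map_mx Re H *m w) = Re (dot (toC v) (H *m toC w)).
  rewrite !dotE Re_sum; apply: eq_bigr => i _.
  rewrite !mxE Re_realM Re_sum; congr (_ * _); apply: eq_bigr => j _.
  by rewrite !mxE mulrC -Re_realM mulrC.
rewrite ReM -!mulmxA dot_mulmx.
rewrite dotE Re_sum; apply: eq_bigr => i _.
rewrite -Re_realM; congr Re.
rewrite mul_diag_mx !mxE mulrCA; congr (_ * (_ * _)).
rewrite rmorph_sum; apply: eq_bigr => j _.
rewrite !mxE rmorphM; congr (_ * _); exact/esym/conjc_real.
Qed.

End ComplexForm.

(** Schur triangularization, as the simultaneous triangularization of a one-element commuting
    family. *)
Lemma unitary_trig (C : numClosedFieldType) n (A : 'M[C]_n) :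
  exists2 U : 'M[C]_n, U *m U^t*%sesqui = 1%:M &
    is_trig_mx (U *m A *m U^t*%sesqui).
Proof.
have [|U Uu] := @cotrigonalization _ _ [:: A].
  by move=> ? ? /=; rewrite !in_cons !orbF => /eqP-> /eqP->.
rewrite all_seq1 => UT; exists U; first exact/unitarymxP.
by rewrite -conjymx.
Qed.

(* [P] is a multiple of the real part of [U^* D U], where [U] brings [M] to
   triangular form and [D] is a diagonal matrix of weights. *)
Lemma hurwitz_lyapunov (R : realType) n (M : 'M[R]_n) : hurwitz M ->
  exists P : 'M[R]_n, [/\ P^T = P,
    exists2 c, 0 < c & forall v : 'cV[R]_n, c * dot v v <= dot v (P *m v) &
    forall v : 'cV[R]_n, 2 * dot v (P *m (M *m v)) <= - dot v v].
Proof.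
move=> hM.
have [U UUs UT] := unitary_trig (complexmx M).
set T := _ *m _ *m _ in UT.
have UsU := mulmx1C UUs.
have UM : U *m complexmx M = T *m U by rewrite /T -mulmxA UsU mulmx1.
(* [T] is similar to [complexmx M], so its diagonal entries are eigenvalues of [M]; a left
   eigenvector [x] of [T] yields [x *m U]. *)
have T0 i : complex.Re (T i i) < 0.
  apply: hM; rewrite eigenvalue_root_char.
  have : root (char_poly T) (T i i).
    rewrite char_poly_trig // /root horner_prod (bigD1 i) //=.
    by rewrite hornerXsubC subrr mul0r.
  rewrite -!eigenvalue_root_char => /eigenvalueP[x xT x0].
  apply/eigenvalueP; exists (x *m U).
    by rewrite -mulmxA UM mulmxA xT scalemxAl.
  apply: contra x0 => /eqP xU; apply/eqP.
  by rewrite -[x]mulmx1 -UUs mulmxA xU mul0mx.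
have [d [d0 [c c0 dP]]] := trig_dissipative UT T0.
have [e e0 eP] := ex_lb_gt0 d0.
pose H (f : 'I_n -> R) :=
  map_mx (@complex.Re R) (U^t*%sesqui *m diag_mx (\row_i real_complex R (f i)) *m U).
have H1 (v : 'cV[R]_n) :
    dot v v = \sum_i Normc.normc ((U *m complexmx v) i 0) ^+ 2.
  have -> : dot v v = dot v (H (fun=> 1) *m v).
    congr dot; rewrite /H (_ : diag_mx _ = 1%:M) ?mulmx1 ?UsU.
      rewrite (_ : map_mx _ _ = 1%:M) ?mul1mx //.
      by apply/matrixP => i j; rewrite !mxE; case: (i == j).
    by apply/matrixP => i j; rewrite !mxE.
  by rewrite /H dot_Re_form; apply: eq_bigr => i _; rewrite mul1r Re_conjM.
(* The factor normalizes the dissipation bound to [- dot v v]. *)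
pose P := (2 * c)^-1 *: H d.
have c20 : 0 < (2 * c)^-1 by rewrite invr_gt0 mulr_gt0.
exists P; split.
- apply: dot_sym_tr => v w; rewrite -!scalemxAl !dotZr !dot_Re_form.
  congr (_ * _); apply: eq_bigr => i _; congr (_ * _).
  by case: ((U *m _) i 0) => a b; case: ((U *m _) i 0) => p q /=; ring.
- exists ((2 * c)^-1 * e); first exact: mulr_gt0.
  move=> v; rewrite -scalemxAl dotZr -mulrA ler_pM2l //.
  rewrite dot_Re_form H1 mulr_sumr; apply: ler_sum => i _.
  by rewrite Re_conjM; apply: ler_wpM2r; rewrite ?sqr_ge0.
- move=> v; rewrite -scalemxAl dotZr dot_Re_form.
  have := dP (U *m complexmx v); rewrite -H1 mulmxA -UM -mulmxA -map_mxM.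
  by rewrite invfM -mulrA mulVKf ?pnatr_eq0 // ler_pdivrMl // mulrN mulNr.
Qed.

(** * Comparison principle *)

(** The point is sought on the left because a minimum over a time interval may sit at its right end;
    truncation at 0 keeps the point in the interval. *)
Lemma is_derive_gt0_left (R : realType) (f : R -> R) (x df : R) :
  0 < x -> is_derive x 1 f df -> 0 < df -> exists2 z, 0 <= z <= x & f z < f x.
Proof.
move=> x0 /is_derive1_caratheodory[g [fE gc gx]] df0.
have : \forall z \near x, 0 < g z.
  by apply: (cvgr_gt _ gc); rewrite gx.
move=> /nbhs_ballP[e /= e0 he].
pose z := Num.max 0 (x - e / 2).
have zx : z < x by rewrite gt_max x0 /=; lra.
exists z; first by rewrite le_max lexx /= ltW.
have gz : 0 < g z.
  apply: he; rewrite /ball /= ger0_norm ?subr_ge0 ?ltW //.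
  have : x - e / 2 <= z by rewrite le_max lexx orbT.
  lra.
rewrite -subr_lt0 fE pmulr_rlt0 //; lra.
Qed.

Lemma dot_eq0 (R : realDomainType) n (v : 'cV[R]_n) : dot v v <= 0 -> v = 0.
Proof.
move=> v0; have {v0}/eqP : dot v v = 0 by apply/eqP; rewrite eq_le v0 dot_ge0.
rewrite dotE psumr_eq0 => [/allP v0|j _]; last by rewrite -expr2 sqr_ge0.
apply/colP => i; rewrite mxE; have := v0 i (mem_index_enum i).
by rewrite /= mulf_eq0 orbb => /eqP.
Qed.

(** The form of [J - l] is nonnegative and vanishes at [u]; moving from [u] along the residual
    [w = J u - l u] would make it negative unless [w = 0]. *)
Lemma rayleigh_min_eigen (R : realFieldType) n (J : 'M[R]_n) (l : R) (u : 'cV[R]_n) :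
  J^T = J -> (forall w, l * dot w w <= dot w (J *m w)) ->
  dot u (J *m u) = l * dot u u -> J *m u = l *: u.
Proof.
move=> sJ lb ub; apply/eqP; rewrite -subr_eq0; apply/eqP.
set w := J *m u - l *: u.
have ww0 : dot w w <= 0.
  set x := dot w w.
  have x0 : 0 <= x by exact: dot_ge0.
  pose c := dot w (J *m w) - l * x.
  have c0 : 0 <= c by rewrite subr_ge0 lb.
  (* Nearly the minimizer [- x / c] of [2 e x + e^2 c]; the shift by 1 allows [c = 0]. *)
  pose e := - (x / (c + 1)).
  have := lb (u + e *: w).
  have wJu : dot w (J *m u) = dot u (J *m w) by rewrite dot_mulmx sJ dotC.
  have xE : x = dot u (J *m w) - l * dot u w.
    by rewrite -wJu /x {2}/w dotBr dotZr [dot w u]dotC.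
  rewrite mulmxDr -scalemxAr !dotDl !dotDr !dotZl !dotZr ub wJu -/x.
  rewrite (dotC w u) (_ : dot w (J *m w) = c + l * x); last by rewrite /c; ring.
  rewrite (_ : dot u (J *m w) = x + l * dot u w); last by rewrite xE; ring.
  move=> h; have {h} : 0 <= 2 * e * x + e ^+ 2 * c by lra.
  have c1 : c + 1 != 0 by apply: lt0r_neq0; lra.
  rewrite (_ : _ + _ = - (x ^+ 2 * (c + 2) / (c + 1) ^+ 2)); last first.
    by rewrite /e; field.
  rewrite oppr_ge0 leNgt; apply: contraNle => x_gt0.
  by apply: divr_gt0; [apply: mulr_gt0; [exact: exprn_gt0|lra]|apply: exprn_gt0; lra].
exact: dot_eq0.
Qed.

(** Each [|v_i v_j|] is at most [dot v v]. This crude norm depends continuously on the entries,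
    which the comparison principle exploits. *)
Lemma dot_norm_le (R : realFieldType) n (A : 'M[R]_n) (v : 'cV[R]_n) :
  dot v (A *m v) <= (\sum_i \sum_j `|A i j|) * dot v v.
Proof.
rewrite [in leLHS]dotE mulr_suml; apply: ler_sum => i _.
rewrite mxE mulr_sumr mulr_suml; apply: ler_sum => j _.
rewrite mulrCA; apply: le_trans (ler_norm _) _; rewrite normrM.
apply: ler_wpM2l => //.
have le_dot k : (v k 0) ^+ 2 <= dot v v.
  rewrite dotE (bigD1 k) //= -expr2 lerDl sumr_ge0 // => l _.
  by rewrite -expr2 sqr_ge0.
have := le_dot i; have := le_dot j; rewrite normrM -!(real_normK (num_real (v _ _))).
have := sqr_ge0 (`|v i 0| - `|v j 0|); nra.
Qed.

Lemma sum_continuous (R : realType) (T : topologicalType) (I : Type) (r : seq I)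
    (F : I -> T -> R) :
  (forall i, continuous (F i)) -> continuous (fun x => \sum_(i <- r) F i x).
Proof.
move=> cF; apply: continuous_big => //; exact: add_continuous.
Qed.

Section DerivePointwise.
Variables (R : realType) (f g : R -> R) (x df dg : R).
Hypotheses (Df : is_derive x 1 f df) (Dg : is_derive x 1 g dg).

Lemma is_derive_add : is_derive x 1 (fun r => f r + g r) (df + dg).
Proof. exact: is_deriveD. Qed.

Lemma is_derive_mul : is_derive x 1 (fun r => f r * g r) (df * g x + f x * dg).
Proof.
have D := is_deriveM Df Dg.
rewrite (_ : _ + _ = f x *: dg + g x *: df); first exact: D.
by rewrite addrC [df * _]mulrC.
Qed.

End DerivePointwise.

Section Positivity.
Variables (R : realType) (n : nat) (J F : R -> 'M[R]_n) (dJ : R -> 'cV[R]_n -> R).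
Hypothesis J_sym : forall t : R, 0 <= t -> (J t)^T = J t.
Hypothesis J_cont : forall i j, continuous (fun t : R => J t i j).
Hypothesis F_cont : forall i j, continuous (fun t : R => F t i j).
Hypothesis J_derive : forall (t : R) v, 0 < t ->
  is_derive t 1 (fun r : R => dot v (J r *m v)) (dJ t v).
Hypothesis J_ineq : forall t v, 0 < t ->
  2 * dot (J t *m v) (F t *m v) <= dJ t v.
Hypothesis J0 : forall v, 0 <= dot v (J 0 *m v).

(* At a negative minimum [(t, u)] of [e^(-K t) u^T J(t) u] over [0, T] times the
   unit sphere, [u] is an eigenvector of [J(t)]; for [K] large the differential
   inequality then makes the time derivative positive there. *)
Lemma lyapunov_nonneg (t : R) v : 0 <= t -> 0 <= dot v (J t *m v).
Proof.
move=> t0.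
have [/dot_eq0->|v0] := leP (dot v v) 0; first by rewrite mulmx0 dot0r.
pose nF s := \sum_i \sum_j `|F s i j|.
have nFc : continuous nF.
  apply: sum_continuous => i; apply: sum_continuous => j s.
  by apply: cvg_norm; exact: F_cont.
have [sF _ hK] := EVT_max t0 (continuous_subspaceT nFc).
set K := nF sF in hK.
(* At a minimum with value [l < 0] of the form, [dJ >= 2 l u^T F u >= 2 K l], hence
   [dJ - k l >= - l > 0]. *)
pose k := 2 * K + 1.
(* Row vectors are used so that [bounded_closed_compact] applies; hence the transposes. *)
pose S := [set u : 'rV[R]_n | dot u^T u^T = 1].
pose g (x : R * 'rV[R]_n) :=
  expR (- k * x.1) * dot x.2^T (J x.1 *m x.2^T).
have unit_mem u : 0 < dot u u -> S ((Num.sqrt (dot u u))^-1 *: u)^T.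
  move=> u0; rewrite /S /= trmxK dotZl dotZr mulrA -expr2 exprVn.
  by rewrite sqr_sqrtr ?dot_ge0 // mulVf ?lt0r_neq0.
have S_compact : compact S.
  apply: bounded_closed_compact.
    exists 1; split=> // M M1 u Su; apply: le_trans (ltW M1).
    rewrite [leLHS]/Num.Def.normr /= mx_normrE; apply: bigmax_le => // -[i j] _ /=.
    rewrite -(@ler_pXn2r _ 2) ?nnegrE // expr1n real_normK ?num_real //.
    rewrite -[leRHS]Su dotE (bigD1 j) //= !mxE (ord1 i) -expr2 lerDl.
    by apply: sumr_ge0 => l _; rewrite -expr2 sqr_ge0.
  pose h (u : 'rV[R]_n) := \sum_i u 0 i * u 0 i.
  have -> : S = h @^-1` [set 1].
    have hE u : dot u^T u^T = h u by rewrite dotE; apply: eq_bigr => i _; rewrite !mxE.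
    by apply/seteqP; split=> u; rewrite /S /= hE.
  apply: preimage_closed; last exact: closed_eq.
  move=> u _; apply: sum_continuous => i w.
  have ci := @coord_continuous R 1 n 0 i.
  by apply: (@continuousM _ _ (fun u : 'rV[R]_n => u 0 i)
    (fun u : 'rV[R]_n => u 0 i)); exact: ci.
have g_cont : continuous g.
  have -> : g = (fun x => expR (- k * x.1) *
      \sum_i x.2 0 i * \sum_j (J x.1 i j * x.2 0 j)).
    apply/funext => x; rewrite /g dotE; congr (_ * _); apply: eq_bigr => i _.
    by rewrite !mxE; congr (_ * _); apply: eq_bigr => j _; rewrite !mxE.
  have c2 i : continuous (fun x : R * 'rV[R]_n => x.2 0 i).
    move=> x; apply: (@continuous_comp _ _ _ snd (fun u : 'rV[R]_n => u 0 i)).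
      exact: cvg_snd.
    exact: (@coord_continuous R 1 n 0 i).
  have c1 (f : R -> R) : continuous f -> continuous (fun x : R * 'rV[R]_n => f x.1).
    move=> fc x; apply: (@continuous_comp _ _ _ fst f); first exact: cvg_fst.
    exact: fc.
  move=> x; apply: cvgM.
    apply: (c1 (fun s => expR (- k * s))) => s.
    apply: continuous_comp; last exact: continuous_expR.
    by apply: cvgM; [exact: cvg_cst|exact: cvg_id].
  apply: sum_continuous => i y; apply: cvgM; first exact: c2.
  apply: sum_continuous => j z; apply: cvgM; last exact: c2.
  exact: (c1 (fun s => J s i j)).
pose A := `[0, t]%classic `*` S.
have A_ne : A !=set0.
  by exists (t, ((Num.sqrt (dot v v))^-1 *: v)^T); split;
    [rewrite /= in_itv /= t0 lexx|exact: unit_mem].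
have A_compact : compact A by apply: compact_setX => //; exact: segment_compact.
have [[s u] /set_mem[/= ]] :=
  compact_EVT_min A_ne A_compact (continuous_subspaceT g_cont).
rewrite in_itv /= => /andP[s0 st] Su gmin.
(* Both sides are homogeneous of degree two in [w], so minimality on the sphere extends to all
   nonzero vectors. *)
have g_min r w : 0 <= r <= t -> 0 < dot w w ->
    g (s, u) * dot w w <= expR (- k * r) * dot w (J r *m w).
  move=> /andP[r0 rt] w0.
  have Ar : A (r, ((Num.sqrt (dot w w))^-1 *: w)^T).
    by split; [rewrite /= in_itv /= r0|exact: unit_mem].
  have := gmin _ (mem_set Ar).
  rewrite {2}/g /= trmxK -scalemxAr dotZl dotZr [_ * (_ * dot _ _)]mulrA -expr2 exprVn.
  rewrite sqr_sqrtr ?dot_ge0 // mulrCA ler_pdivlMl //.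
  by rewrite mulrC.
have [g_ge0|g_lt0] := leP 0 (g (s, u)).
  have := g_min t v; rewrite t0 lexx => /(_ isT v0) h.
  rewrite -(pmulr_rge0 _ (expR_gt0 (- k * t))); apply: le_trans h.
  by rewrite mulr_ge0 // ltW.
exfalso.
pose l := dot u^T (J s *m u^T).
have l0 : l < 0 by move: g_lt0; rewrite /g /= pmulr_rlt0 ?expR_gt0.
have s_gt0 : 0 < s.
  rewrite lt_def s0 andbT; apply/eqP => s_eq0.
  by move: l0; rewrite /l s_eq0 ltNge J0.
have eigen : J s *m u^T = l *: u^T.
  apply: rayleigh_min_eigen; [exact: J_sym| |by rewrite Su mulr1].
  move=> w; have [/dot_eq0->|w0] := leP (dot w w) 0.
    by rewrite mulmx0 !dot0r mulr0.
  have := g_min s w; rewrite s0 st => /(_ isT w0).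
  by rewrite /g /= -mulrA ler_pM2l ?expR_gt0.
pose f r := expR (- k * r) * dot u^T (J r *m u^T).
have f_derive : is_derive s 1 f (expR (- k * s) * (dJ s u^T - k * l)).
  have h : is_derive s 1 (fun r : R => - k * r) (0 * s + - k * 1).
    by apply: is_derive_mul.
  have e1 := is_derive1_comp (is_derive_expR _) h.
  by apply: is_derive_eq; [exact: (is_derive_mul e1 (J_derive u^T s_gt0))|
    rewrite /= -/l; ring].
(* A positive time derivative at [s] gives a smaller value at an earlier time, against
   minimality. *)
have [|z /andP[z0 zs]] := is_derive_gt0_left s_gt0 f_derive.
  rewrite pmulr_rgt0 ?expR_gt0 //.
  have hJ := J_ineq u^T s_gt0; rewrite eigen dotZl in hJ.
  have := dot_norm_le (F s) u^T; rewrite Su mulr1 -/(nF s) => hF.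
  have hs : nF s <= K by apply: hK; rewrite in_itv /= s0 st.
  have : l * K <= l * dot u^T (F s *m u^T).
    by rewrite ler_nM2l //; apply: le_trans hs.
  rewrite /k; lra.
rewrite ltNge => /negP; apply.
have := g_min z u^T; rewrite Su z0 (le_trans zs st) mulr1 => /(_ isT ltr01).
by [].
Qed.

End Positivity.

(** * The Riccati flow *)

Lemma is_derive_bigsum (R : realType) n (h : 'I_n -> R -> R) (dh : 'I_n -> R) (x : R) :
  (forall i, is_derive x 1 (h i) (dh i)) ->
  is_derive x 1 (fun r => \sum_i h i r) (\sum_i dh i).
Proof.
move=> Dh; have D := is_derive_sum Dh.
rewrite (_ : (fun r => _) = \sum_i h i) //.
by apply/funext => r; rewrite fct_sumE.
Qed.

Lemma is_derive_dot (R : realType) n (Y : R -> 'M[R]_n) (dY : 'M[R]_n) (x : R)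
    (u v : 'cV[R]_n) :
  is_derive x 1 Y dY ->
  is_derive x 1 (fun r => dot u (Y r *m v)) (dot u (dY *m v)).
Proof.
move=> [Yd YdE].
have Yij i j : is_derive x 1 (fun r => Y r i j) (dY i j).
  by split; [have /derivable_mxP := Yd|rewrite -YdE derive_mx // mxE].
pose f i r := \sum_j Y r i j * v j 0.
have -> : (fun r => dot u (Y r *m v)) = (fun r => \sum_i u i 0 * f i r).
  by apply/funext => r; rewrite dotE; apply: eq_bigr => i _; rewrite !mxE.
have -> : dot u (dY *m v) = \sum_i (0 * f i x + u i 0 * \sum_j dY i j * v j 0).
  by rewrite dotE; apply: eq_bigr => i _; rewrite mul0r add0r !mxE.
apply: is_derive_bigsum => i; apply: is_derive_mul.
apply: is_derive_bigsum => j.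
rewrite (_ : dY i j * v j 0 = dY i j * v j 0 + Y x i j * 0); last first.
  by rewrite mulr0 addr0.
exact: is_derive_mul.
Qed.

Lemma mx_cvg (R : realType) (T : Type) (D : set_system T) m n
    (f : T -> 'M[R]_(m, n)) (M : 'M[R]_(m, n)) : Filter D ->
  (forall i j, f t i j @[t --> D] --> M i j) -> f t @[t --> D] --> M.
Proof.
move=> FD fM U [P MP PU].
have : \forall t \near D, forall i j, P i j (f t i j).
  by apply: filter_forall => i; apply: filter_forall => j; exact: fM.
by apply: filterS => t tP; exact: PU.
Qed.

(** Freezing a solution at its initial value for negative times makes it continuous on the whole
    line, as the comparison principle requires. *)
Lemma continuous_max0 (R : realType) (T : topologicalType) (f : R -> T) :
  {within `[0, +oo[, continuous f} -> continuous (fun t : R => f (Num.max 0 t)).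
Proof.
move=> /subspace_continuousP fc t.
apply: (@cvg_comp _ _ _ (fun s : R => Num.max 0 s) f); last first.
  by apply: fc; rewrite /= in_itv /= le_max lexx.
have mc : continuous (fun s : R => Num.max 0 s).
  by move=> s; apply: continuous_max; [exact: cvg_cst|exact: cvg_id].
move=> U /= hU.
have : nbhs t (fun s : R => `[0, +oo[%classic (Num.max 0 s) -> U (Num.max 0 s)).
  exact: mc hU.
apply: filterS => s; apply.
by rewrite /= in_itv /= le_max lexx.
Qed.

Section RiccatiFlow.
Variables (R : realType) (n s p : nat) (A : 'M[R]_n) (B : 'M[R]_(n, s))
  (C : 'M[R]_(p, n)) (W : R -> 'M[R]_n).
Hypothesis W_cont : forall i j, continuous (fun t : R => W t i j).
Hypothesis W_derive : forall (t : R) u v, 0 < t ->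
  is_derive t 1 (fun r => dot u (W r *m v)) (dot u (riccati A B C (W t) *m v)).
Hypothesis W0_sym : (W 0)^T = W 0.

Let F t := A - B *m B^T *m W t.

Lemma dot_riccati (M : 'M[R]_n) u v :
  dot u (riccati A B C M *m v) = dot (A *m u) (M *m v) + dot u (M *m (A *m v))
    - dot u (M *m (B *m (B^T *m (M *m v)))) + dot (C *m u) (C *m v).
Proof.
rewrite /riccati !mulmxDl mulNmx !dotDr dotNr -!mulmxA.
by rewrite (dot_mulmx A^T) (dot_mulmx C^T) !trmxK.
Qed.

Lemma dot_riccati_sym (M : 'M[R]_n) v : M^T = M ->
  dot v (riccati A B C M *m v) = 2 * dot (M *m v) (A *m v)
    - dot (B^T *m (M *m v)) (B^T *m (M *m v)) + dot (C *m v) (C *m v).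
Proof.
move=> sM; rewrite dot_riccati (dot_mulmx M v) (dot_mulmx M v) sM.
by rewrite (dot_mulmx B) (dotC (A *m v)); ring.
Qed.

Lemma closed_loop_cont i j : continuous (fun t : R => F t i j).
Proof.
have -> : (fun t => F t i j) =
    (fun t => A i j + \sum_k (- (B *m B^T) i k) * W t k j).
  apply/funext => t; rewrite !mxE -sumrN; congr (_ + _).
  by apply: eq_bigr => k _; rewrite mulNr.
move=> t; apply: cvgD; first exact: cvg_cst.
apply: sum_continuous => k r; apply: cvgM; first exact: cvg_cst.
exact: W_cont.
Qed.

(* [W - W^T] is skew, but the block matrix [[0, W - W^T], [W^T - W, 0]] is
   symmetric and satisfies a differential Lyapunov equation. *)
Lemma riccati_flow_sym t : 0 <= t -> (W t)^T = W t.
Proof.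
move=> t0.
pose D r := W r - (W r)^T.
pose J r : 'M[R]_(n + n) := block_mx 0 (D r) (- D r) 0.
pose FF r : 'M[R]_(n + n) := block_mx (F r) 0 0 (F r).
have dot_col (a b c d : 'cV[R]_n) :
    dot (col_mx a b) (col_mx c d) = dot a c + dot b d.
  by rewrite /dot tr_col_mx mul_row_col mxE.
have JE r a b : dot (col_mx a b) (J r *m col_mx a b) =
    2 * (dot a (W r *m b) - dot b (W r *m a)).
  rewrite mul_block_col !mul0mx add0r addr0 dot_col mulNmx dotNr !mulmxBl !dotBr.
  rewrite (dot_mulmx (W r)^T a) (dot_mulmx (W r)^T b) trmxK.
  by rewrite (dotC _ b) (dotC _ a); ring.
pose dJ r v := 2 * (dot (usubmx v) (riccati A B C (W r) *m dsubmx v)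
  - dot (dsubmx v) (riccati A B C (W r) *m usubmx v)).
have J_ge0 v : 0 <= dot v (J t *m v).
  apply: (@lyapunov_nonneg R _ J FF dJ) => //.
  - move=> r _; rewrite tr_block_mx !trmx0 /D linearN /= linearB /= trmxK.
    by rewrite /J /D !opprB.
  - move=> i j; rewrite /J /D.
    case: (split_ordP i) => i' ->; case: (split_ordP j) => j' -> x.
    + under eq_fun do rewrite block_mxEul mxE; exact: cvg_cst.
    + under eq_fun do rewrite block_mxEur !mxE; apply: cvgB; exact: W_cont.
    + under eq_fun do rewrite block_mxEdl !mxE; apply: cvgN; apply: cvgB; exact: W_cont.
    + under eq_fun do rewrite block_mxEdr mxE; exact: cvg_cst.
  - move=> i j; rewrite /FF.
    case: (split_ordP i) => i' ->; case: (split_ordP j) => j' -> x.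
    + under eq_fun do rewrite block_mxEul; exact: closed_loop_cont.
    + under eq_fun do rewrite block_mxEur mxE; exact: cvg_cst.
    + under eq_fun do rewrite block_mxEdl mxE; exact: cvg_cst.
    + under eq_fun do rewrite block_mxEdr; exact: closed_loop_cont.
  - move=> r w r0; rewrite -(vsubmxK w).
    under eq_fun do rewrite JE.
    rewrite /dJ col_mxKu col_mxKd.
    set a := usubmx w; set b := dsubmx w.
    have D0 := is_derive_cst (2 : R) r (1 : R).
    have D1 := is_deriveB (W_derive a b r0) (W_derive b a r0).
    by have := is_derive_mul D0 D1; rewrite mul0r add0r.
  (* With [S = B B^T], the mixed terms [W^T S W] of [F^T D] and [D F] cancel, so [D' = F^T D + D F]
     and the inequality is an equality. *)
  - move=> r w r0; rewrite -(vsubmxK w) /dJ col_mxKu col_mxKd.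
    set a := usubmx w; set b := dsubmx w.
    rewrite !mul_block_col !mul0mx !add0r !addr0 dot_col !dot_riccati.
    rewrite /F /D !mulmxBl mulNmx mulmxBl !dotNl !dotBl !dotBr.
    rewrite -!(dot_mulmx (W r)) -!mulmxA.
    rewrite (dot_mulmx B (W r *m a)) (dot_mulmx B (W r *m b)).
    rewrite (dotC (A *m a)) (dotC (A *m b)) (dotC (C *m b)) (dotC (B^T *m (W r *m a))).
    lra.
  - move=> w; rewrite -(vsubmxK w) JE.
    by rewrite (dot_mulmx (W 0)) W0_sym dotC subrr mulr0.
apply: dot_sym_tr => a b; apply/eqP.
(* Exchanging [a] and [b] changes the sign of the form, so nonnegativity forces it to vanish. *)
have := J_ge0 (col_mx a b); have := J_ge0 (col_mx b a); rewrite !JE => h1 h2.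
by rewrite eq_le; apply/andP; split; lra.
Qed.

(** A common form of the comparisons below: [g P + X - W], [k P - t (W - X)] and
    [t (W - X) + k (P + c W)] are all [(a0 + a1 t) W + N0 + t N1]. *)
Lemma riccati_flow_affine_nonneg (G : R -> 'M[R]_n) (a0 a1 : R) (N0 N1 : 'M[R]_n) :
  N0^T = N0 -> N1^T = N1 -> (forall i j, continuous (fun t : R => G t i j)) ->
  (forall (t : R) v, 0 < t ->
    2 * ((a0 + a1 * t) * dot (W t *m v) (G t *m v) + dot (N0 *m v) (G t *m v)
         + t * dot (N1 *m v) (G t *m v)) <=
    a1 * dot v (W t *m v) + (a0 + a1 * t) * dot v (riccati A B C (W t) *m v)
      + dot v (N1 *m v)) ->
  (forall v, 0 <= a0 * dot v (W 0 *m v) + dot v (N0 *m v)) ->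
  forall (t : R) v, 0 <= t ->
    0 <= (a0 + a1 * t) * dot v (W t *m v) + dot v (N0 *m v)
         + t * dot v (N1 *m v).
Proof.
move=> sN0 sN1 Gc ineq J0 t v t0.
pose J r := (a0 + a1 * r) *: W r + N0 + r *: N1.
have JE r u w : dot u (J r *m w) =
    (a0 + a1 * r) * dot u (W r *m w) + dot u (N0 *m w) + r * dot u (N1 *m w).
  by rewrite !mulmxDl -!scalemxAl !dotDr !dotZr.
rewrite -JE.
pose dJ r w := a1 * dot w (W r *m w)
  + (a0 + a1 * r) * dot w (riccati A B C (W r) *m w) + dot w (N1 *m w).
apply: (@lyapunov_nonneg R n J G dJ) => //.
- move=> r r0; rewrite /J !raddfD /= !linearZ /= sN0 sN1.
  by rewrite riccati_flow_sym.
- move=> i j; have -> : (fun r => J r i j) =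
      (fun r => (a0 + a1 * r) * W r i j + N0 i j + r * N1 i j).
    by apply/funext => r; rewrite !mxE.
  move=> r; apply: cvgD; first apply: cvgD.
  + apply: cvgM; last exact: W_cont.
    apply: cvgD; first exact: cvg_cst.
    by apply: cvgM; [exact: cvg_cst|exact: cvg_id].
  + exact: cvg_cst.
  + by apply: cvgM; [exact: cvg_id|exact: cvg_cst].
- move=> r w r0.
  rewrite (_ : (fun x => _) = (fun x => (a0 + a1 * x) * dot w (W x *m w)
      + dot w (N0 *m w) + x * dot w (N1 *m w))); last first.
    by apply/funext => x; rewrite JE.
  have cst_der (c : R) := is_derive_cst c r (1 : R).
  have D1 := is_derive_add (cst_der a0)
    (is_derive_mul (cst_der a1) (is_derive_id r 1)).
  have D2 := is_derive_mul D1 (W_derive w w r0).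
  have D3 := is_derive_mul (is_derive_id r 1) (cst_der (dot w (N1 *m w))).
  have D := is_derive_add (is_derive_add D2 (cst_der (dot w (N0 *m w)))) D3.
  apply: (is_derive_eq D).
  by rewrite /dJ /cst /=; ring.
- move=> r w r0; apply: le_trans (ineq r w r0).
  by rewrite !mulmxDl -!scalemxAl !dotDl !dotZl.
- move=> w; rewrite JE; have := J0 w; rewrite mul0r mulr0 addr0.
  by rewrite addr0.
Qed.

(** Relative to the closed loop [F], the derivative of [W] exceeds [F^T W + W F] by
    [W B B^T W + C^T C], which is nonnegative. *)
Lemma riccati_flow_nonneg : (forall v, 0 <= dot v (W 0 *m v)) ->
  forall (t : R) v, 0 <= t -> 0 <= dot v (W t *m v).
Proof.
move=> W0 t v t0.
apply: (@lyapunov_nonneg R n W F (fun r w => dot w (riccati A B C (W r) *m w))) => //.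
- exact: riccati_flow_sym.
- exact: closed_loop_cont.
- move=> r w r0; rewrite (dot_riccati_sym w (riccati_flow_sym (ltW r0))).
  rewrite /F mulmxBl dotBr -!mulmxA (dot_mulmx B).
  have := dot_ge0 (B^T *m (W r *m w)); have := dot_ge0 (C *m w); lra.
Qed.

End RiccatiFlow.

(** * Convergence of the flow to the stabilizing solution *)

Lemma dot_mulmx_le (R : realFieldType) m n (M : 'M[R]_(m, n)) :
  exists2 k, 0 <= k & forall v : 'cV[R]_n, dot (M *m v) (M *m v) <= k * dot v v.
Proof.
exists (\sum_i \sum_j `|(M^T *m M) i j|).
  by apply: sumr_ge0 => i _; apply: sumr_ge0.
move=> v; rewrite -{1}[M]trmxK -dot_mulmx mulmxA; exact: dot_norm_le.
Qed.

Lemma young (R : realFieldType) n (u v : 'cV[R]_n) (k : R) : 0 < k ->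
  2 * dot u v <= dot u u / k + k * dot v v.
Proof.
move=> k0; have := dot_ge0 (u - k *: v).
rewrite dotBl !dotBr !dotZl !dotZr (dotC v u) => h.
rewrite -(ler_pM2l k0) mulrDr [k * (_ / k)]mulrC divfK ?lt0r_neq0 //; lra.
Qed.

Section Convergence.
Variables (R : realType) (n s p : nat) (A : 'M[R]_n) (B : 'M[R]_(n, s))
  (C : 'M[R]_(p, n)) (X : 'M[R]_n) (W : R -> 'M[R]_n).
Hypothesis W_cont : forall i j, continuous (fun t : R => W t i j).
Hypothesis W_derive : forall (t : R) u v, 0 < t ->
  is_derive t 1 (fun r => dot u (W r *m v)) (dot u (riccati A B C (W t) *m v)).
Hypothesis W0_sym : (W 0)^T = W 0.
Hypothesis W0_ge0 : forall v, 0 <= dot v (W 0 *m v).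
Hypothesis X_sym : X^T = X.
Hypothesis X_ge0 : forall v, 0 <= dot v (X *m v).
Hypothesis X_riccati : riccati A B C X = 0.
Hypothesis X_stab : stabilizing A B X.
Hypothesis CA_detect : detectable C A.

(** The quadratic form of the error matrix [W t - X]; all estimates are made on forms. *)
Let E t v := dot v (W t *m v) - dot v (X *m v).

Let are v : 2 * dot (X *m v) (A *m v)
  - dot (B^T *m (X *m v)) (B^T *m (X *m v)) + dot (C *m v) (C *m v) = 0.
Proof. by rewrite -dot_riccati_sym // X_riccati mul0mx dot0r. Qed.

Let dre t v : 0 < t -> dot v (riccati A B C (W t) *m v) =
  2 * dot (W t *m v) (A *m v)
  - dot (B^T *m (W t *m v)) (B^T *m (W t *m v)) + dot (C *m v) (C *m v).
Proof.
move=> t0; apply: dot_riccati_sym.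
exact: (riccati_flow_sym W_cont W_derive W0_sym (ltW t0)).
Qed.

(** Relative to the constant matrix [A - B B^T X], the quadratic term of the error equation is
    [- E B B^T E], which only helps an upper bound. A bound on [E] comes first and then feeds the
    one on [t E]. *)
Lemma riccati_flow_le : exists2 k, 0 <= k & forall (t : R) v, 0 <= t ->
  E t v <= k * dot v v /\ t * E t v <= k * dot v v.
Proof.
have [P [sP [c c0 cP] PA]] := hurwitz_lyapunov X_stab.
pose w0 := \sum_i \sum_j `|W 0 i j|.
have w0_ge0 : 0 <= w0 by apply: sumr_ge0 => i _; apply: sumr_ge0.
pose q := \sum_i \sum_j `|P i j|.
have q_ge0 : 0 <= q by apply: sumr_ge0 => i _; apply: sumr_ge0.
have qP v : dot v (P *m v) <= q * dot v v by exact: dot_norm_le.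
(* Since [g c = w0], the matrix [g P] dominates [W 0], hence also [W 0 - X]. *)
pose g := w0 / c.
have g_ge0 : 0 <= g by rewrite divr_ge0 // ltW.
have Acl_cont i j : continuous (fun _ : R => (A - B *m B^T *m X) i j).
  by move=> r; exact: cvg_cst.
have PA' v : 2 * dot (P *m v) ((A - B *m B^T *m X) *m v) <= - dot v v.
  by have := PA v; rewrite (dot_mulmx P v) sP.
have WB r v : dot (W r *m v) ((A - B *m B^T *m X) *m v) =
    dot (W r *m v) (A *m v) - dot (B^T *m (W r *m v)) (B^T *m (X *m v)).
  by rewrite mulmxBl dotBr -!mulmxA (dot_mulmx B).
have XB v : dot (X *m v) ((A - B *m B^T *m X) *m v) =
    dot (X *m v) (A *m v) - dot (B^T *m (X *m v)) (B^T *m (X *m v)).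
  by rewrite mulmxBl dotBr -!mulmxA (dot_mulmx B).
(* The form of [(W - X) B B^T (W - X)], expanded. *)
have sq r v : 0 <= dot (B^T *m (W r *m v)) (B^T *m (W r *m v))
    - 2 * dot (B^T *m (W r *m v)) (B^T *m (X *m v))
    + dot (B^T *m (X *m v)) (B^T *m (X *m v)).
  have := dot_ge0 (B^T *m (W r *m v) - B^T *m (X *m v)).
  by rewrite dotBl !dotBr (dotC (B^T *m (X *m v))); lra.
have E_le t v : 0 <= t -> E t v <= g * dot v (P *m v).
  move=> t0.
  have : 0 <= (-1 + 0 * t) * dot v (W t *m v) + dot v ((g *: P + X) *m v)
      + t * dot v (0 *m v).
    apply: (riccati_flow_affine_nonneg W_cont W_derive W0_sym
      (G := fun=> A - B *m B^T *m X)) => //.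
    - by rewrite raddfD /= linearZ /= sP X_sym.
    - exact: trmx0.
    - move=> r w r0; rewrite dre // !mul0mx [(g *: P + X) *m _]mulmxDl.
      rewrite -scalemxAl !dotDl !dotZl WB XB dot0l dot0r.
      have := sq r w; have := ler_wpM2l g_ge0 (PA' w); have := are w.
      have := mulr_ge0 g_ge0 (dot_ge0 w); lra.
    - move=> w; rewrite mulmxDl -scalemxAl dotDr dotZr.
      have h1 : dot w (W 0 *m w) <= w0 * dot w w by exact: dot_norm_le.
      have := ler_wpM2l g_ge0 (cP w).
      by rewrite mulrA /g divfK ?lt0r_neq0 // -/g; have := X_ge0 w; lra.
  by rewrite mul0mx dot0r mulmxDl -scalemxAl dotDr dotZr /E; lra.
pose k := g * q.
have k_ge0 : 0 <= k by exact: mulr_ge0.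
have E_le' t v : 0 <= t -> E t v <= k * dot v v.
  move=> t0; apply: le_trans (E_le t v t0) _.
  by rewrite /k -mulrA; apply: ler_wpM2l.
(* Differentiating [t E] adds the term [E], at most [k |v|^2]; the dissipation of [k P] absorbs
   exactly that much. *)
have tE_le t v : 0 <= t -> t * E t v <= k * dot v (P *m v).
  move=> t0.
  have : 0 <= (0 + (-1) * t) * dot v (W t *m v) + dot v ((k *: P) *m v)
      + t * dot v (X *m v).
    apply: (riccati_flow_affine_nonneg W_cont W_derive W0_sym
      (G := fun=> A - B *m B^T *m X)) => //.
    - by rewrite linearZ /= sP.
    - move=> r w r0; rewrite dre // -scalemxAl dotZl WB XB.
      have := mulr_ge0 (ltW r0) (sq r w); have := ler_wpM2l k_ge0 (PA' w).
      have := E_le' r w (ltW r0); rewrite /E.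
      have : r * (2 * dot (X *m w) (A *m w)
        - dot (B^T *m (X *m w)) (B^T *m (X *m w)) + dot (C *m w) (C *m w)) = 0.
        by rewrite are mulr0.
      lra.
    - move=> w; rewrite mul0r add0r -scalemxAl dotZr mulr_ge0 //.
      by apply: le_trans (cP w); rewrite mulr_ge0 ?dot_ge0 ?ltW.
  by rewrite -scalemxAl dotZr /E; lra.
exists (k + k * q); first by rewrite addr_ge0 // mulr_ge0.
move=> t v t0; split.
  by have := E_le' t v t0; have := mulr_ge0 (mulr_ge0 k_ge0 q_ge0) (dot_ge0 v); lra.
have := tE_le t v t0; have := ler_wpM2l k_ge0 (qP v).
by have := mulr_ge0 k_ge0 (dot_ge0 v); lra.
Qed.

(** Relative to [F = A - B B^T W], the error equation has the term [+ E B B^T E], favorable to a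
    lower bound. As [F] is not known to be stable, [P + c W] replaces a Lyapunov matrix: [c W] gains
    [c (W B B^T W + C^T C)], which pays for passing from [A - L C] to [F] in [P]. *)
Lemma riccati_flow_ge : exists2 k, 0 <= k & forall (t : R) v, 0 <= t ->
  - (k * dot v v) <= t * E t v.
Proof.
have [L AL] := CA_detect.
have [P [sP [e e0 eP] PA]] := hurwitz_lyapunov AL.
have [g g0 gE] := riccati_flow_le.
have [m1 m1_ge0 m1P] := dot_mulmx_le (L^T *m P).
have [m2 m2_ge0 m2P] := dot_mulmx_le (B^T *m P).
pose x := \sum_i \sum_j `|X i j|.
have x_ge0 : 0 <= x by apply: sumr_ge0 => i _; apply: sumr_ge0.
have xX v : dot v (X *m v) <= x * dot v v by exact: dot_norm_le.
pose q := \sum_i \sum_j `|P i j|.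
have q_ge0 : 0 <= q by apply: sumr_ge0 => i _; apply: sumr_ge0.
have qP v : dot v (P *m v) <= q * dot v v by exact: dot_norm_le.
(* Large enough for the remainders [(m1 + m2) / c] of Young's inequality to use up at most half of
   the dissipation of [P]. *)
pose c := 2 * (m1 + m2 + 1).
have c0 : 0 < c by rewrite /c; lra.
pose F t := A - B *m B^T *m W t.
pose a t v := dot (B^T *m (W t *m v)) (B^T *m (W t *m v)).
have WF t v : dot (W t *m v) (F t *m v) = dot (W t *m v) (A *m v) - a t v.
  by rewrite mulmxBl dotBr -!mulmxA (dot_mulmx B).
have XF t v : dot (X *m v) (F t *m v) = dot (X *m v) (A *m v)
    - dot (B^T *m (W t *m v)) (B^T *m (X *m v)).
  by rewrite mulmxBl dotBr -!mulmxA (dot_mulmx B) (dotC (B^T *m (X *m v))).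
have PF t v : 2 * dot (P *m v) (F t *m v) <=
    - (dot v v / 2) + c * (a t v + dot (C *m v) (C *m v)).
  have -> : F t *m v = (A - L *m C) *m v + L *m (C *m v) - B *m (B^T *m (W t *m v)).
    by rewrite /F !mulmxBl -!mulmxA subrK.
  rewrite dotBr dotDr (dot_mulmx L) (dot_mulmx B).
  have := PA v; rewrite (dot_mulmx P v) sP.
  have := young (L^T *m (P *m v)) (C *m v) c0.
  have := young (- (B^T *m (P *m v))) (B^T *m (W t *m v)) c0.
  rewrite !dotNl !dotNr opprK -/(a t v).
  have := m1P v; have := m2P v; rewrite -!mulmxA => h2 h1.
  have hm : (m1 * dot v v + m2 * dot v v) / c <= dot v v / 2.
    rewrite ler_pdivrMr // /c; have := dot_ge0 v; lra.
  have : dot (L^T *m (P *m v)) (L^T *m (P *m v)) / c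
     + dot (B^T *m (P *m v)) (B^T *m (P *m v)) / c <= dot v v / 2.
    by apply: le_trans hm; rewrite -mulrDl ler_pM2r ?invr_gt0 //; lra.
  lra.
have sq r v : 0 <= a r v
    - 2 * dot (B^T *m (W r *m v)) (B^T *m (X *m v))
    + dot (B^T *m (X *m v)) (B^T *m (X *m v)).
  have := dot_ge0 (B^T *m (W r *m v) - B^T *m (X *m v)).
  by rewrite dotBl !dotBr (dotC (B^T *m (X *m v))) /a; lra.
have W_ge0 := riccati_flow_nonneg W_cont W_derive W0_sym W0_ge0.
(* The gain [1/2] of [P + c W], times [k], offsets the term [E >= - X >= - x] produced by
   differentiating [t E]. *)
pose k := 2 * x.
have k_ge0 : 0 <= k by rewrite mulr_ge0.
have tE_ge t v : 0 <= t ->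
    0 <= t * E t v + k * (dot v (P *m v) + c * dot v (W t *m v)).
  move=> t0.
  have : 0 <= (k * c + 1 * t) * dot v (W t *m v) + dot v ((k *: P) *m v)
      + t * dot v (- X *m v).
    apply: (riccati_flow_affine_nonneg W_cont W_derive W0_sym (G := F)) => //.
    - by rewrite linearZ /= sP.
    - by rewrite linearN /= X_sym.
    - exact: closed_loop_cont.
    - move=> r w r0; rewrite dre // -scalemxAl dotZl mulNmx dotNl dotNr WF XF.
      rewrite -/(a r w).
      have := mulr_ge0 (ltW r0) (sq r w); have := ler_wpM2l k_ge0 (PF r w).
      have := W_ge0 r w (ltW r0); have := xX w.
      have : r * (2 * dot (X *m w) (A *m w)
        - dot (B^T *m (X *m w)) (B^T *m (X *m w)) + dot (C *m w) (C *m w)) = 0.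
        by rewrite are mulr0.
      rewrite /k; lra.
    - move=> w; rewrite -scalemxAl dotZr addr_ge0 // mulr_ge0 //.
        by rewrite mulr_ge0 // ltW.
      by apply: le_trans (eP w); rewrite mulr_ge0 ?dot_ge0 ?ltW.
  by rewrite -scalemxAl dotZr mulNmx dotNr /E; lra.
(* Here [W = E + X] is bounded by [g + x] through the upper bound on [E]. *)
exists (k * (q + c * (g + x))).
  by rewrite mulr_ge0 // addr_ge0 // mulr_ge0 ?addr_ge0 // ltW.
move=> t v t0; have := tE_ge t v t0.
have : k * (dot v (P *m v) + c * dot v (W t *m v)) <=
    k * (q * dot v v + c * (g * dot v v + x * dot v v)).
  apply: ler_wpM2l => //; apply: lerD => //; rewrite ler_pM2l //.
  by have [+ _] := gE t v t0; rewrite /E; have := xX v; lra.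
lra.
Qed.

(** The two bounds make the form of [t (W - X)] bounded; by polarization the entries of [W - X] are
    [O(1/t)]. *)
Lemma riccati_flow_cvg : W t @[t --> +oo] --> X.
Proof.
have [k1 k1_ge0 le1] := riccati_flow_le.
have [k2 k2_ge0 le2] := riccati_flow_ge.
pose k := k1 + k2.
have kE (t : R) v : 0 <= t -> `|t * E t v| <= k * dot v v.
  move=> t0; have [_ h1] := le1 t v t0; have h2 := le2 t v t0.
  rewrite ler_norml /k; have := mulr_ge0 k1_ge0 (dot_ge0 v).
  by have := mulr_ge0 k2_ge0 (dot_ge0 v); move=> ? ?; apply/andP; split; lra.
apply: mx_cvg => i j; apply/cvgrPdist_le => /= eps eps0.
pose d l : 'cV[R]_n := delta_mx l 0.
have dd l : dot (d l) (d l) <= 1.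
  by rewrite /dot /d trmx_delta mul_delta_mx mxE !eqxx.
near=> t.
have t0 : 0 < t by near: t; apply: nbhs_pinfty_gt; exact: num_real.
have sW := riccati_flow_sym W_cont W_derive W0_sym (ltW t0).
pose x := W t i j - X i j.
have polar (M : 'M[R]_n) : M^T = M -> 2 * M i j =
    dot (d i + d j) (M *m (d i + d j)) - dot (d i) (M *m d i) - dot (d j) (M *m d j).
  move=> sM; rewrite mulmxDr !dotDl !dotDr (dot_mulmx M (d j) (d i)) sM.
  by rewrite (dotC (M *m d j)) !dot_delta; ring.
have xE : 2 * (t * x) = t * E t (d i + d j) - t * E t (d i) - t * E t (d j).
  rewrite (_ : 2 * (t * x) = t * (2 * W t i j - 2 * X i j)); last by rewrite /x; ring.
  by rewrite !polar // /E; ring.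
have k_ge0 : 0 <= k by exact: addr_ge0.
have hi := kE t (d i) (ltW t0); have hj := kE t (d j) (ltW t0).
have hij := kE t (d i + d j) (ltW t0).
have dij : dot (d i + d j) (d i + d j) <= 4.
  have := dot_ge0 (d i - d j); have := dd i; have := dd j.
  rewrite !dotDl !dotDr !dotNl !dotNr (dotC (d j) (d i)); lra.
have := ler_wpM2l k_ge0 dij; have := ler_wpM2l k_ge0 (dd i).
have := ler_wpM2l k_ge0 (dd j) => bj bi bij.
rewrite distrC -/x.
(* Polarization gives [(4 k + k + k) / 2]. *)
have htx : `|t * x| <= 3 * k.
  move: hi hj hij; rewrite !ler_norml => /andP[? ?] /andP[? ?] /andP[? ?].
  by apply/andP; split; lra.
have ht : 3 * k / eps <= t by near: t; apply: nbhs_pinfty_ge; exact: num_real.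
rewrite normrM gtr0_norm // in htx.
rewrite -(ler_pM2l t0); apply: le_trans htx _.
by rewrite -ler_pdivrMr.
Unshelve. all: by end_near. Qed.

End Convergence.

(** * Orthogonal change of basis *)

Lemma orthonormal_cols_rank (F : fieldType) n d (V : 'M[F]_(n, d)) :
  V^T *m V = 1%:M -> \rank V = d.
Proof.
move=> VV; apply/eqP; rewrite eqn_leq rank_leq_col /=.
by have := mxrankM_maxr V^T V; rewrite VV mxrank1.
Qed.

(** A left eigenvector [x] of the conjugate gives the left eigenvector [x V^T] of [M]. *)
Lemma hurwitz_orthogonal_conj (R : realType) n (V M : 'M[R]_n) :
  V *m V^T = 1%:M -> hurwitz M -> hurwitz (V^T *m M *m V).
Proof.
move=> VVt hM l /eigenvalueP[x xE x0]; apply: hM.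
have VVtC : complexmx V *m complexmx V^T = 1%:M.
  by rewrite -map_mxM VVt map_mx1.
apply/eigenvalueP; exists (x *m complexmx V^T).
  rewrite scalemxAl -xE /complexmx !map_mxM -!mulmxA.
  by rewrite VVtC mulmx1.
apply: contra x0 => /eqP xV.
by rewrite -[x]mulmx1 -(mulmx1C VVtC) mulmxA xV mul0mx.
Qed.

Lemma riccati_orthogonal_conj (R : realType) n s p (A : 'M[R]_n)
    (B : 'M[R]_(n, s)) (C : 'M[R]_(p, n)) (V X : 'M[R]_n) : V *m V^T = 1%:M ->
  riccati (V^T *m A *m V) (V^T *m B) (C *m V) (V^T *m X *m V) =
  V^T *m riccati A B C X *m V.
Proof.
move=> VVt; have VK m (M : 'M[R]_(n, m)) : V *m (V^T *m M) = M.
  by rewrite mulmxA VVt mul1mx.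
rewrite /riccati !(mulmxDr, mulmxDl, mulmxN, mulNmx) !trmx_mul !trmxK.
by rewrite -!mulmxA !VK.
Qed.

Theorem proposition5p2 (R : realType) (n s p q : nat)
    (A : 'M[R]_n) (B : 'M[R]_(n, s)) (C : 'M[R]_(p, n)) (Z : 'M[R]_(n, q))
    (Xinf : 'M[R]_n)
    (k : krylov_kind R) (m d : nat) (V : 'M[R]_(n, d)) (Y : R -> 'M[R]_d) :
  A \in unitmx ->
  stabilizable A B ->
  detectable C A ->
  sym_nonneg Xinf ->
  riccati A B C Xinf = 0 ->
  stabilizing A B Xinf ->
  krylov_basis k A^T (row_mx C^T Z) m V ->
  \rank V = n ->
  dre_solution (V^T *m A *m V) (V^T *m B) (C *m V) (V^T *m Z) Y ->
  V *m lim (Y t @[t --> +oo]) *m V^T = Xinf.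
Proof.
move=> _ _ [L AL] [sX X_ge0] areX stabX [VV _] rankV.
have dn : d = n by rewrite -rankV (orthonormal_cols_rank VV).
(* Eliminating [d = n] with all dependent data generalized makes [V] square, so that [V V^T = 1]
   follows. *)
case: _ / dn A B C Z Xinf V Y {rankV} L AL sX X_ge0 areX stabX VV.
move=> A B C Z X V Y L AL sX X_ge0 areX stabX VV [Yc Yd Y0].
have VVt := mulmx1C VV.
pose W t := Y (Num.max 0 t).
have WE (t : R) : 0 <= t -> W t = Y t by move=> t0; rewrite /W max_r.
have W0E : W 0 = V^T *m Z *m (V^T *m Z)^T by rewrite WE.
have Wcvg : W t @[t --> +oo] --> V^T *m X *m V.
  (* The hypotheses on [X] transfer to [V^T X V] by orthogonal conjugation; the reduced closed loop
     is [V^T (A - B B^T X) V]. *)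
  apply: (@riccati_flow_cvg R d s p (V^T *m A *m V) (V^T *m B) (C *m V)).
  - move=> i j t.
    apply: (@continuous_comp _ _ _ W (fun M : 'M[R]_d => M i j)).
      exact: continuous_max0.
    exact: coord_continuous.
  - move=> t u v t0; apply: is_derive_dot.
    rewrite WE ?ltW //; apply: near_eq_is_derive (Yd t t0).
    near=> r; rewrite WE // ltW //; near: r; exact: lt_nbhsr.
  - by rewrite W0E trmx_mul trmxK.
  - by move=> v; rewrite W0E -mulmxA dot_mulmx dot_ge0.
  - by rewrite !trmx_mul trmxK sX mulmxA.
  - move=> v; rewrite -!mulmxA dot_mulmx trmxK.
    by rewrite /dot [_^T *m (_ *m _)]mulmxA; exact: X_ge0.
  - by rewrite riccati_orthogonal_conj // areX mulmx0 mul0mx.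
  - have := hurwitz_orthogonal_conj VVt stabX; rewrite /stabilizing.
    rewrite mulmxBr mulmxBl trmx_mul trmxK -!mulmxA.
    by rewrite (mulmxA V V^T) VVt mul1mx.
  (* The detectability gain in the new basis. *)
  - exists (V^T *m L); have := hurwitz_orthogonal_conj VVt AL.
    by rewrite mulmxBr mulmxBl -!mulmxA.
have Ycvg : Y t @[t --> +oo] --> V^T *m X *m V.
  apply: cvg_trans Wcvg; apply: near_eq_cvg.
  near=> t; rewrite WE //; near: t; apply: nbhs_pinfty_ge; exact: num_real.
rewrite (cvg_lim _ Ycvg) //.
by rewrite !mulmxA VVt mul1mx -mulmxA VVt mulmx1.
Unshelve. all: by end_near. Qed.
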